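(* Let $q\geq 3$ and let $m$ be a positive integer divisible by $q$. Then there exist a code $C$ in the Hamming graph $\Gamma=H(m,q)$ with minimum distance $\delta=3$ and a group $X\leq \mathrm{Aut}(\Gamma)$ such that $(C,X)$ is an elusive pair with parameters $(m,q,3)$ and $X$ acts transitively on $\Gamma_1(C)$.
   Context: Hamming graph: for a finite set $Q$ of size $q$, $\Gamma=H(m,q)$ is the graph whose vertices are all $m$-tuples with entries in $Q$, two $m$-tuples being adjacent if and only if they differ in exactly one position. $\mathrm{Aut}(\Gamma)$ is its automorphism group. The distance $d(\alpha,\beta)$ between vertices is the number of entries in which they differ. A code is a subset $C$ of the vertex set of $\Gamma$; its minimum distance is $\delta=\min\{d(\alpha,\beta)\mid \alpha,\beta\in C,\ \alpha\neq\beta\}$. The set of neighbours of $C$, denoted $\Gamma_1(C)$, is the set of all vertices of $\Gamma$ that are not in $C$ but are adjacent to at least one element of $C$. Elusive pair: let $C$ be a code in $\Gamma=H(m,q)$ with minimum distance $\delta$ and let $X\leq\mathrm{Aut}(\Gamma)$ be such that $X$ fixes $\Gamma_1(C)$ setwise but does not fix $C$ setwise. Then $(C,X)$ is called an elusive pair with parameters $(m,q,\delta)$. *)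

(* Defs.v *)
From mathcomp Require Import all_boot all_fingroup.

Set Implicit Arguments.
Unset Strict Implicit.
Unset Printing Implicit Defensive.

Import GroupScope.

Section GraphAut.
Variables (T : finType) (e : rel T).

Definition graph_aut : {set {perm T}} :=
  [set s : {perm T} | [forall x, forall y, e (s x) (s y) == e x y]].

Lemma graph_autP (s : {perm T}) :
  reflect (forall x y, e (s x) (s y) = e x y) (s \in graph_aut).
Proof.
rewrite inE; apply: (iffP forallP) => [h x y | h x].
  by have /forallP/(_ y)/eqP := h x.
by apply/forallP => y; apply/eqP.
Qed.

Lemma graph_aut_group_set : group_set graph_aut.
Proof.
apply/group_setP; split=> [|s t /graph_autP hs /graph_autP ht].
  by apply/graph_autP => x y; rewrite !perm1.
by apply/graph_autP => x y; rewrite !permM ht hs.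
Qed.

Canonical graph_aut_group := Group graph_aut_group_set.

End GraphAut.

Section Hamming.
Variables (m : nat) (Q : finType).
Implicit Types (C : {set m.-tuple Q}) (X : {group {perm m.-tuple Q}}).

Definition hamming_dist (a b : m.-tuple Q) : nat :=
  #|[set i : 'I_m | tnth a i != tnth b i]|.

Definition hamming_adj : rel (m.-tuple Q) :=
  fun a b => hamming_dist a b == 1%N.

(* Relational, so that no value is chosen for a code with at most one
   codeword: such a code has no minimum distance. *)
Definition min_distance C (delta : nat) : Prop :=
  (exists a b, [/\ a \in C, b \in C, a != b & hamming_dist a b = delta]) /\
  (forall a b, a \in C -> b \in C -> a != b -> delta <= hamming_dist a b).

Definition code_neighbours C : {set m.-tuple Q} :=
  [set v | (v \notin C) && [exists c in C, hamming_adj v c]].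

(* The parameters m and q = #|Q| are carried by the type of C. *)
Definition elusive_pair C X (delta : nat) : Prop :=
  [/\ min_distance C delta,
      X \subset graph_aut hamming_adj,
      [acts X, on code_neighbours C | 'P]
    & ~~ [acts X, on C | 'P]].

End Hamming.

(* Main.v *)
(** Identify the m positions with [Q * 'I_n], where [m = n * q], so that the
    positions split into n blocks of size q.  A permutation of the positions
    that preserves every block spells a word in which each letter occurs exactly
    once in every block.  The code C consists of the words of the even such
    permutations; words of distinct even permutations differ in at least three
    entries.  Overwriting one entry of a word by another entry of the same block
    gives a vertex adjacent to exactly two words, whose permutations differ by a
    transposition; so C and the set of words of odd permutations have the same
    neighbours.  Permuting positions and letters compatibly with the blocks is
    transitive on these neighbours, and a transposition of two positions of a
    block moves C. *)
Require Import Defs.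
From mathcomp Require Import all_boot all_fingroup.

Set Implicit Arguments.
Unset Strict Implicit.
Unset Printing Implicit Defensive.

Import GroupScope.

(** * Two facts about permutations of a finite set *)

Lemma perm_diff_ge3 (T : finType) (s t : {perm T}) :
  s = t :> bool -> s != t -> 2 < #|[set x | s x != t x]|.
Proof.
move=> par; apply: contraR; rewrite -leqNgt => le2; apply/eqP.
set D := [set x | _] in le2.
pose u := s * t^-1.
have inD x : (x \in D) = (u x != x).
  by rewrite inE permM (can2_eq (permKV t) (permK t)).
have evenu : u = false :> bool by rewrite odd_permM odd_permV par addbb.
suff u1 : u = 1 by apply: (mulIg t^-1); rewrite mulgV.
(* If [u] moves [x], it also moves [u x]; with at most two moved points it is the transposition of
   these two, which is odd. *)
apply/permP => x; rewrite perm1; apply/eqP/negPn/negP => ux.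
have Dx : D = [set x; u x].
  apply/esym/eqP; rewrite eqEcard cards2 eq_sym ux le2 andbT.
  by apply/subsetP => y /set2P[] ->; rewrite inD // (inj_eq perm_inj).
have uux : u (u x) = x.
  have : u (u x) \in D by rewrite inD !(inj_eq perm_inj).
  by rewrite Dx => /set2P[] // /perm_inj e; rewrite e eqxx in ux.
suff eu : u = tperm x (u x) by move: evenu; rewrite eu odd_tperm eq_sym ux.
apply/permP => y; case: tpermP => [->|->|/eqP yx /eqP yux] //.
apply/eqP; rewrite -[_ == _]negbK -inD Dx !inE negb_or.
by rewrite yx.
Qed.

Lemma perm_move2 (T : finType) (a b c d : T) :
  a != b -> c != d -> exists s : {perm T}, s a = c /\ s b = d.
Proof.
(* The second transposition fixes [c], because both [d] and the image of [b] under the first differ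
   from [c]. *)
move=> ab cd; exists (tperm a c * tperm (tperm a c b) d).
rewrite !permM tpermL; split; last exact: tpermL.
rewrite tpermD // eq_sym // -{1}(tpermL a c) (inj_eq perm_inj) //.
Qed.

(** * Block-preserving permutations and their words *)

Section BlockCode.

Variables (m : nat) (Q K : finType).
Variables (b : 'I_m -> Q * K) (g : Q * K -> 'I_m).
Hypotheses (bK : cancel b g) (gK : cancel g b).

Local Notation vertex := (m.-tuple Q).
Implicit Types (i j x y : 'I_m) (s t r p u : {perm 'I_m}) (v w : vertex).

Definition block i : K := (b i).2.

Lemma letter_block_inj i j : (b i).1 = (b j).1 -> block i = block j -> i = j.
Proof.
rewrite /block => e1 e2; apply: (can_inj bK).
by case: (b i) (b j) e1 e2 => [? ?] [? ?] /= -> ->.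
Qed.

Definition block_preserving s := [forall i, block (s i) == block i].

Lemma block_preservingP s :
  reflect (forall i, block (s i) = block i) (block_preserving s).
Proof. by apply: (iffP forallP) => h i; apply/eqP. Qed.

Lemma block_preserving1 : block_preserving 1.
Proof. by apply/block_preservingP => i; rewrite perm1. Qed.

Lemma block_preservingM s t :
  block_preserving s -> block_preserving t -> block_preserving (s * t).
Proof.
move=> /block_preservingP hs /block_preservingP ht.
by apply/block_preservingP => i; rewrite permM ht hs.
Qed.

Lemma block_preservingV s i : block_preserving s -> block (s^-1 i) = block i.
Proof. by move=> /block_preservingP hs; rewrite -hs permKV. Qed.

Lemma block_preserving_tperm i j :
  block i = block j -> block_preserving (tperm i j).
Proof.
by move=> ij; apply/block_preservingP => x; case: tpermP => [->|->|].
Qed.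

Definition word s : vertex := [tuple (b (s i)).1 | i < m].

(** Both [s i] and [t i] lie in the block of [i], where a position is determined by its letter. *)
Lemma word_tnth_eq s t i : block_preserving s -> block_preserving t ->
  (tnth (word s) i == tnth (word t) i) = (s i == t i).
Proof.
move=> /block_preservingP hs /block_preservingP ht; rewrite !tnth_mktuple.
apply/eqP/eqP => [e|-> //].
by apply: letter_block_inj; rewrite ?hs ?ht.
Qed.

Lemma word_inj s t : block_preserving s -> block_preserving t ->
  word s = word t -> s = t.
Proof.
move=> hs ht e; apply/permP => i; apply/eqP.
by rewrite -word_tnth_eq // e.
Qed.

Lemma hamming_dist_word s t : block_preserving s -> block_preserving t ->
  hamming_dist (word s) (word t) = #|[set i | s i != t i]|.
Proof. by move=> hs ht; apply: eq_card => i; rewrite !inE word_tnth_eq. Qed.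

Definition block_code : {set vertex} :=
  [set word s | s : {perm 'I_m} & block_preserving s && ~~ odd_perm s].

Lemma block_codeP v :
  reflect (exists s, [/\ block_preserving s, s = false :> bool & v = word s])
          (v \in block_code).
Proof.
apply: (iffP imsetP) => [[s]|[s [hs es ->]]].
  by rewrite inE => /andP[hs /negbTE es] ->; exists s.
by exists s; rewrite // inE hs es.
Qed.

(** * Overwritten words as the neighbours of the code *)

Definition overwrite w i j : vertex :=
  [tuple tnth w (if x == i then j else x) | x < m].

(** Multiplying by [tperm i j] on the left swaps the entries at [i] and [j], so on both sides these
    positions end up with the entry of [word s] at [i]. This allows the parity of the permutation to
    be chosen. *)
Lemma overwrite_word_tperm s i j :
  overwrite (word (tperm i j * s)) i j = overwrite (word s) j i.
Proof.
apply: eq_from_tnth => x; rewrite !tnth_mktuple !permM.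
have [->|xi] := eqVneq x i; first by rewrite tpermR if_same.
have [->|xj] := eqVneq x j; first by rewrite tpermR.
by rewrite tpermD // eq_sym.
Qed.

(** No parity is imposed on [s], since the automorphisms used below may change it. *)
Definition broken_words : {set vertex} :=
  [set v | [exists s, exists i, exists j,
    [&& block_preserving s, i != j, block i == block j
      & v == overwrite (word s) i j]]].

Lemma broken_wordsP v :
  reflect (exists s i j, [/\ block_preserving s, i != j, block i = block j
                           & v = overwrite (word s) i j])
          (v \in broken_words).
Proof.
rewrite inE; apply: (iffP existsP) => [[s]|[s [i [j [hs ij bij ->]]]]].
  case/existsP=> i /existsP[j /and4P[hs ij /eqP bij /eqP ->]].
  by exists s, i, j.
exists s; apply/existsP; exists i; apply/existsP; exists j.
by rewrite hs ij bij !eqxx.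
Qed.

Lemma broken_words_even v : v \in broken_words ->
  exists s i j, [/\ block_preserving s, s = false :> bool, i != j,
                    block i = block j & v = overwrite (word s) i j].
Proof.
case/broken_wordsP => s [i [j [hs ij bij ->]]].
case es: (odd_perm s); last by exists s, i, j.
exists (tperm j i * s), j, i; split; rewrite 1?eq_sym ?overwrite_word_tperm //.
  by apply: block_preservingM => //; apply: block_preserving_tperm.
by rewrite odd_mul_tperm es eq_sym ij.
Qed.

Lemma code_neighbours_block_code : code_neighbours block_code = broken_words.
Proof.
apply/setP => v; apply/idP/idP.
  rewrite inE => /andP[_ /existsP[_ /andP[/block_codeP[s [hs _ ->]]]]].
  move=> /cards1P[i di].
  have dE x : (tnth v x != tnth (word s) x) = (x == i).
    by have := congr1 (fun A : {set 'I_m} => x \in A) di; rewrite !inE.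
  (* The position in the block of [i] where [word s] carries the letter that [v] has at [i]. *)
  pose j := s^-1 (g (tnth v i, block i)).
  have sj : b (s j) = (tnth v i, block i) by rewrite permKV gK.
  have bij : block i = block j.
    by rewrite block_preservingV // /block gK.
  apply/broken_wordsP; exists s, i, j; split=> //.
    apply/eqP => ij; have := dE i.
    by rewrite eqxx tnth_mktuple {2}ij sj eqxx.
  apply: eq_from_tnth => x; rewrite tnth_mktuple.
  have [->|xi] := eqVneq x i; first by rewrite tnth_mktuple sj.
  by apply/eqP; rewrite -[_ == _]negbK dE.
case/broken_words_even => s [i [j [hs es ij bij ->]]]; rewrite inE.
apply/andP; split.
  (* The overwritten word repeats a letter at [i] and [j], within one block; the word of a
     block-preserving permutation never does. *)
  apply/block_codeP => -[t [ht _ e]].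
  have tE x : tnth (overwrite (word s) i j) x = (b (t x)).1.
    by rewrite e tnth_mktuple.
  move/eqP: ij; apply; apply: (@perm_inj _ t); apply: letter_block_inj.
    by rewrite -!tE !tnth_mktuple eqxx if_same.
  by move/block_preservingP: ht => ht; rewrite !ht.
apply/existsP; exists (word s); apply/andP; split.
  by apply/block_codeP; exists s.
apply/cards1P; exists i; apply/setP => x; rewrite !inE tnth_mktuple.
have [->|xi] := eqVneq x i; last by rewrite eqxx.
rewrite !tnth_mktuple; apply: contra ij => /eqP e.
apply/eqP/(@perm_inj _ s)/esym/letter_block_inj => //.
by move/block_preservingP: hs => hs; rewrite !hs.
Qed.

(** * Automorphisms permuting positions and letters *)

(* The letter a at position [p x] stands for the position [g (a, block (p x))];
   the map sends the word of r to the word of [p * r * u]. *)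
Definition twist_fun p u v : vertex :=
  [tuple (b (u (g (tnth v (p x), block (p x))))).1 | x < m].

(** On blocks, [u] undoes [p]; hence [p * r * u] preserves blocks whenever [r] does. *)
Definition compatible p u :=
  forall x y, block x = block (p y) -> block (u x) = block y.

(** Compatibility puts both images under [u] in the block of [x], where the letter determines the
    position. *)
Lemma twist_letter_eq p u x (a c : Q) : compatible p u ->
  ((b (u (g (a, block (p x))))).1 == (b (u (g (c, block (p x))))).1) = (a == c).
Proof.
move=> cpu; apply/eqP/eqP => [e|-> //].
have /perm_inj/(can_inj gK)[] // :
  u (g (a, block (p x))) = u (g (c, block (p x))).
apply: letter_block_inj => //.
by rewrite (cpu _ x) 1?(cpu _ x) // {1}/block gK.
Qed.

Lemma hamming_dist_twist p u v w : compatible p u ->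
  hamming_dist (twist_fun p u v) (twist_fun p u w) = hamming_dist v w.
Proof.
move=> cpu; rewrite /hamming_dist.
(* The positions where the images differ are the preimage under [p] of those where [v] and [w]
   differ. *)
rewrite -(card_preimset [set i | tnth v i != tnth w i] (@perm_inj _ p)).
by apply: eq_card => x; rewrite !inE !tnth_mktuple twist_letter_eq.
Qed.

Lemma twist_inj p u : compatible p u -> injective (twist_fun p u).
Proof.
move=> cpu v w e; apply: eq_from_tnth => x.
have /eqP := congr1 (fun c : vertex => tnth c (p^-1 x)) e.
by rewrite !tnth_mktuple twist_letter_eq // permKV => /eqP.
Qed.

Definition twist p u (cpu : compatible p u) : {perm vertex} := perm (twist_inj cpu).

Lemma twist_word p u r (cpu : compatible p u) : block_preserving r ->
  twist cpu (word r) = word (p * r * u).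
Proof.
move=> /block_preservingP hr; rewrite permE; apply: eq_from_tnth => x.
by rewrite !tnth_mktuple !permM -hr /block -surjective_pairing bK.
Qed.

Lemma twist_block_preserving p u r : compatible p u -> block_preserving r ->
  block_preserving (p * r * u).
Proof.
move=> cpu /block_preservingP hr; apply/block_preservingP => x.
by rewrite !permM; apply: cpu.
Qed.

Lemma twist_overwrite p u w i j (cpu : compatible p u) : block i = block j ->
  twist cpu (overwrite w i j) = overwrite (twist cpu w) (p^-1 i) (p^-1 j).
Proof.
move=> bij; rewrite permE [twist cpu w]permE; apply: eq_from_tnth => x; rewrite !tnth_mktuple.
rewrite -(can2_eq (permK p) (permKV p)).
(* A letter is decoded relative to the block of its position, so copying from [j] to [i] commutes
   with the twist because they share a block. *)
by have [->|] := eqVneq (p x) i; rewrite ?permKV ?bij.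
Qed.

Lemma twist_broken_words p u v (cpu : compatible p u) :
  v \in broken_words -> twist cpu v \in broken_words.
Proof.
case/broken_wordsP => s [i [j [hs ij bij ->]]].
apply/broken_wordsP; exists (p * s * u), (p^-1 i), (p^-1 j); split.
- exact: twist_block_preserving.
- by rewrite (inj_eq perm_inj).
- by rewrite -(cpu i) ?permKV // (cpu _ (p^-1 j)) // permKV.
- by rewrite twist_overwrite // twist_word.
Qed.

(** With the whole setwise stabiliser, invariance is automatic; the twists serve to show
    transitivity and that the code is moved. *)
Definition twist_group :=
  'N_(graph_aut_group (@hamming_adj m Q))(broken_words | 'P)%G.

Lemma twist_in_group p u (cpu : compatible p u) : twist cpu \in twist_group.
Proof.
rewrite inE; apply/andP; split.
  by apply/graph_autP => v w; rewrite /hamming_adj !permE hamming_dist_twist.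
rewrite !inE /=; apply/subsetP => v vB; rewrite inE.
exact: twist_broken_words.
Qed.

(** * Transitivity on the overwritten words *)

Lemma block_respecting_move2 i j i' j' :
  i != j -> block i = block j -> i' != j' -> block i' = block j' ->
  exists p, [/\ p i' = i, p j' = j
    & forall x y, block (p x) = block (p y) -> block x = block y].
Proof.
move=> ij bij ij' bij'.
have letter_neq x y : x != y -> block x = block y -> (b x).1 != (b y).1.
  by move=> xy bxy; apply: contra xy => /eqP e; apply/eqP/letter_block_inj.
have [a [ai aj]] := perm_move2 (letter_neq _ _ ij' bij') (letter_neq _ _ ij bij).
pose c := tperm (block i') (block i).
(* Acting by [a] on letters and by [c] on blocks independently respects the blocks. *)
have f_inj : injective (fun x => g (a (b x).1, c (block x))).
  by move=> x y /(can_inj gK)[] /perm_inj e1 /perm_inj e2; apply: letter_block_inj.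
exists (perm f_inj); split=> [||x y]; rewrite ![perm f_inj _]permE.
- by rewrite ai /c tpermL /block -surjective_pairing bK.
- by rewrite aj /c -bij' tpermL bij /block -surjective_pairing bK.
- by rewrite /block !gK => /perm_inj.
Qed.

Lemma broken_words_sub_orbit v :
  v \in broken_words -> broken_words \subset orbit 'P twist_group v.
Proof.
case/broken_wordsP => s [i [j [hs ij bij ->]]].
apply/subsetP => _ /broken_wordsP[t [i' [j' [ht ij' bij' ->]]]].
have [p [pi pj hp]] := block_respecting_move2 ij bij ij' bij'.
(* The second component solves [p * s * u = t], so the twist sends [word s] to [word t]. *)
have cpu : compatible p (s^-1 * p^-1 * t).
  move=> x y bxy; rewrite !permM; move/block_preservingP: ht => ->.
  by apply: hp; rewrite permKV block_preservingV.
apply/orbitP; exists (twist cpu); first exact: twist_in_group.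
rewrite /= apermE twist_overwrite // twist_word // -pi -pj !permK.
by rewrite !mulgA mulgK mulgV mul1g.
Qed.

(** * Elusiveness and minimum distance *)

Lemma block_code_elusive i j k :
  uniq [:: i; j; k] -> block i = block j -> block j = block k ->
  elusive_pair block_code twist_group 3 /\
  [transitive twist_group, on code_neighbours block_code | 'P].
Proof.
rewrite /= !inE negb_or andbT => /andP[/andP[ij ik] jk] bij bjk.
have hij := block_preserving_tperm bij.
have h1 := block_preserving1.
have acts : [acts twist_group, on broken_words | 'P] by apply: subsetIr.
rewrite /elusive_pair code_neighbours_block_code; split.
  split=> //; first 1 last.
  - exact: subsetIl.
  (* This twist sends [word 1] to [word (tperm i j)], the word of an odd permutation. *)
  - have cpu : compatible (tperm i j) 1.
      by move=> x y; rewrite perm1 => ->; apply/block_preservingP.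
    apply/negP => actsC.
    have : word 1 \in block_code.
      by apply/block_codeP; exists 1; rewrite odd_perm1.
    rewrite -(astabs_act _ (subsetP actsC _ (twist_in_group cpu))) /= apermE.
    rewrite twist_word // !mulg1 => /block_codeP[s [hs es]] /word_inj e.
    by move: es; rewrite -e // odd_tperm ij.
  - split=> [|_ _ /block_codeP[s [hs es ->]] /block_codeP[t [ht et ->]]].
      (* Distance 3 is attained by the identity and a 3-cycle, which is even. *)
      pose s := tperm i j * tperm j k.
      have hs : block_preserving s.
        by apply: block_preservingM => //; apply: block_preserving_tperm.
      have dE : [set x | (1 : {perm 'I_m}) x != s x] = [set i; j; k].
        apply/setP => x; rewrite !inE perm1 permM.
        case: (tpermP i j x) => [->|->|/eqP xi /eqP xj].
        + by rewrite tpermL ik eqxx.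
        + by rewrite tpermD 1?eq_sym // eqxx orbT.
        case: (tpermP j k x) xi xj => [->|->|/eqP _ /eqP xk] xi xj.
        + by rewrite eqxx in xj.
        + by rewrite xj eqxx orbT.
        + by rewrite eqxx (negbTE xi) (negbTE xj) (negbTE xk).
      have d3 : hamming_dist (word 1) (word s) = 3.
        rewrite hamming_dist_word // dE -setUA cardsU1 cards2 jk !inE.
        by rewrite negb_or ij ik.
      exists (word 1), (word s); split=> //.
      + by apply/block_codeP; exists 1; rewrite odd_perm1.
      + apply/block_codeP; exists s; split=> //.
        by rewrite odd_permM !odd_tperm ij jk.
      + apply: contra_eq_neq d3 => <-; rewrite hamming_dist_word //.
        by rewrite (_ : [set _ | _] = set0) ?cards0 //;
           apply/setP => x; rewrite !inE eqxx.
    move=> st; rewrite hamming_dist_word //; apply: perm_diff_ge3.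
      by rewrite es et.
    by apply: contra st => /eqP ->.
have v0B : overwrite (word 1) i j \in broken_words.
  by apply/broken_wordsP; exists 1, i, j.
apply/imsetP; exists (overwrite (word 1) i j) => //.
by apply/eqP; rewrite eqEsubset broken_words_sub_orbit ?acts_sub_orbit.
Qed.

End BlockCode.

Theorem theorem1p2 (q m : nat) (Q : finType) (cardQ : #|Q| = q)
    (q_ge3 : 3 <= q) (m_gt0 : 0 < m) (q_dvd_m : q %| m) :
  exists (C : {set m.-tuple Q}) (X : {group {perm m.-tuple Q}}),
    elusive_pair C X 3 /\
    [transitive X, on code_neighbours C | 'P].
Proof.
have n_gt0 : 0 < m %/ q by rewrite divn_gt0 ?(ltn_trans _ q_ge3) // dvdn_leq.
pose k0 := Ordinal n_gt0.
have cardm : m = #|{: Q * 'I_(m %/ q)}|.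
  by rewrite card_prod card_ord cardQ mulnC divnK.
pose b (i : 'I_m) := enum_val (cast_ord cardm i).
pose g (a : Q * 'I_(m %/ q)) := cast_ord (esym cardm) (enum_rank a).
have bK : cancel b g by move=> i; rewrite /g enum_valK cast_ordK.
have gK : cancel g b by move=> a; rewrite /b cast_ordKV enum_rankK.
(* Three distinct letters, all placed in the block [k0], give the three positions for the
   3-cycle. *)
have /card_gt2P[a0 [a1 [a2 [_ [a01 a12 a20]]]]] : 2 < #|Q| by rewrite cardQ.
exists (block_code b), (twist_group b).
apply: (block_code_elusive bK gK (i := g (a0, k0)) (j := g (a1, k0))
  (k := g (a2, k0))); rewrite /block ?gK //.
rewrite /= !inE !(inj_eq (can_inj gK)) !xpair_eqE !eqxx !andbT.
by rewrite negb_or a01 a12 eq_sym a20.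
Qed.
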